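(* For all integers $r\ge 2$, $n\ge 0$ and $0\le j\le n$, the number $$\binom{2n}n^{-1}\binom{2j}j\,t_{n,j}^{(r)}$$ is an integer, where $$t_{n,j}^{(r)}=\sum_{k=j}^n(-1)^{n-k}d_{n,k}\binom{k+j}{k-j}^r,\qquad d_{n,k}=\binom{2n}{n-k}-\binom{2n}{n-k-1}=\frac{2k+1}{n+k+1}\binom{2n}{n-k}.$$
   Context: Binomial coefficients $\binom ab$ with $b<0$ are equal to $0$ (so $d_{n,n}=1$). *)

(* Defs.v *)
(* Mathematical Components world. *)
From mathcomp Require Import all_boot all_order all_algebra.
From mathcomp Require Import zify ring.

Set Implicit Arguments.
Unset Strict Implicit.
Unset Printing Implicit Defensive.

Import Order.TTheory GRing.Theory Num.Theory.
Local Open Scope ring_scope.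

(* The lower index is an integer because truncated subtraction on nat would
   give 'C(2n, n - k - 1) = 1 instead of 0 at k = n. *)
Definition binz (a : nat) (b : int) : int :=
  match b with
  | Posz m => 'C(a, m)%:Z
  | Negz _ => 0
  end.

Definition d (n k : nat) : int :=
  binz (2 * n) (n%:Z - k%:Z) - binz (2 * n) (n%:Z - k%:Z - 1).

(* The truncated subtractions n - k and k - j are exact: j <= k <= n. *)
Definition t (r n j : nat) : int :=
  \sum_(j <= k < n.+1) (-1) ^+ (n - k) * d n k * 'C(k + j, k - j)%:Z ^+ r.

Lemma d_diag (n : nat) : d n n = 1.
Proof. by rewrite /d subrr /= bin0. Qed.

Lemma dE (n k : nat) : (k <= n)%N ->
  (d n k)%:~R =
    (2 * k + 1)%:R / (n + k + 1)%:R * (binz (2 * n) (n%:Z - k%:Z))%:~R :> rat.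
Proof.
move=> le_kn.
have nz : (n + k + 1)%:R != 0 :> rat by rewrite pnatr_eq0 addn1.
suff E : (n + k + 1)%:Z * d n k =
         (2 * k + 1)%:Z * binz (2 * n) (n%:Z - k%:Z).
  apply: (mulfI nz); rewrite mulrA mulrCA mulfV // mulr1.
  by have /(congr1 (fun z : int => z%:~R : rat)) := E; rewrite !rmorphM.
rewrite /d subzn //; case: (ltngtP k n) le_kn => // [lt_kn|->] _; last first.
  by rewrite subnn /= bin0; lia.
case def_m: (n - k)%N => [|m]; first by lia.
have -> : m.+1%:Z - 1 = m%:Z by lia.
rewrite /=.
have E : (m.+1 * 'C(2 * n, m.+1) = (n + k + 1) * 'C(2 * n, m))%N.
  by rewrite mul_bin_left; congr (_ * _)%N; lia.
have Hm : (m.+1 + k = n)%N by lia.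
rewrite -Hm in E *.
nia.
Qed.

(* Main.v *)
Require Import Defs.
From mathcomp Require Import all_boot all_order all_algebra.
From mathcomp Require Import zify ring.

Import Order.TTheory GRing.Theory Num.Theory.
Local Open Scope ring_scope.

(** Write p_j(k) = C(k + j, 2j) and q_m(k) = C(k, m) C(k + m, m) ([legendre]),
    so that q_m = C(2m, m) p_m. The numbers d_{n,k} with alternating signs
    invert the triangular matrix (p_m(k)) ([d_orthogonal]). Hence t_{n,j}^{(r)}
    is the coefficient of p_n in the expansion of p_j^r, and the theorem asserts
    that C(2j, j) p_j^r = q_j p_j^(r-1) is an integral combination of the q_m.

    All p_m and q_m are polynomials in x = k (k + 1), and
    (m + 1)^2 q_{m+1} = (x - m (m + 1)) q_m.  This gives the linearization
      q_n q_j = \sum_i C(j, i) C(n + i, j) C(n + j, j) q_{n+i}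
    ([legendre_mul], a form of the Pfaff-Saalschuetz identity).  Division by
    C(2j, j) destroys the integrality of the coefficients: for example
    q_2 p_1 = 3 q_2 + (9/2) q_3, so that the lattice spanned by the q_m is not
    stable under multiplication by p_j.  The sublattice spanned by the
    C(m, j) q_m is stable: since C(n, j) C(n + j, j) = C(2j, j) C(n + j, 2j),
      C(n, j) q_n p_j = C(n + j, 2j) \sum_i C(j, i) C(n + i, j) q_{n+i}
    ([bin_legendre_mul]).  It contains q_j = C(j, j) q_j, hence every
    q_j p_j^s ([power_expansion]). *)

(** Up to sign, the coefficient of X^n in the k-th shifted Legendre polynomial;
    it is the q_n(k) of the comments. *)
Definition legendre (n k : nat) : int := 'C(k, n)%:Z * 'C(k + n, n)%:Z.

(** Over the integers the absorption rule needs no condition b <= a, because the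
    binomial coefficient vanishes when the factor a - b is negative. *)
Lemma mul_binz_left (a b : nat) :
  (b.+1)%:Z * 'C(a, b.+1)%:Z = (a%:Z - b%:Z) * 'C(a, b)%:Z.
Proof.
case: (leqP b a) => [le_ba | lt_ab]; last by rewrite !bin_small //; lia.
by rewrite subzn // -!PoszM mul_bin_left.
Qed.

Lemma mul_binz_diag (a b : nat) :
  (b.+1)%:Z * 'C(a.+1, b.+1)%:Z = (a.+1)%:Z * 'C(a, b)%:Z.
Proof. by rewrite -!PoszM -mul_bin_diag. Qed.

Lemma bin_add_central (n j : nat) :
  ('C(n, j) * 'C(n + j, j) = 'C(2 * j, j) * 'C(n + j, 2 * j))%N.
Proof.
case: (leqP j n) => [le_jn | lt_nj]; last first.
  by rewrite (@bin_small n) // (@bin_small _ (2 * j)) ?muln0 ?mul0n //; lia.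
have f1 := bin_fact le_jn.
have f2 := bin_fact (leq_addl n j).
have le2 : (2 * j <= n + j)%N by lia.
have f3 := bin_fact le2.
have le3 : (j <= 2 * j)%N by lia.
have f4 := bin_fact le3.
rewrite addnK in f2.
have e1 : (n + j - 2 * j = n - j)%N by lia.
have e2 : (2 * j - j = j)%N by lia.
rewrite e1 in f3; rewrite e2 in f4.
have pos : (0 < j`! * (j`! * (n - j)`!))%N by rewrite !muln_gt0 !fact_gt0.
apply/eqP; rewrite -(eqn_pmul2r pos); apply/eqP.
transitivity (n + j)`!.
  by rewrite -f2 -f1; ring.
by rewrite -f3 -f4; ring.
Qed.

Lemma legendre_central (n k : nat) :
  legendre n k = 'C(2 * n, n)%:Z * 'C(k + n, 2 * n)%:Z.
Proof. by rewrite /legendre -!PoszM bin_add_central. Qed.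

Lemma legendre_small (n k : nat) : (k < n)%N -> legendre n k = 0.
Proof. by move=> lt_kn; rewrite /legendre bin_small. Qed.

(** As a polynomial in x = k (k + 1), q_n is the product of the x - m (m + 1)
    over m < n, divided by (n!)^2. *)
Lemma legendre_recr (n k : nat) :
  (n.+1)%:Z ^+ 2 * legendre n.+1 k =
  (k%:Z * (k.+1)%:Z - n%:Z * (n.+1)%:Z) * legendre n k.
Proof.
have a := mul_binz_left k n; have b := mul_binz_diag (k + n) n.
rewrite /legendre addnS.
transitivity (((n.+1)%:Z * 'C(k, n.+1)%:Z) *
              ((n.+1)%:Z * 'C((k + n).+1, n.+1)%:Z)).
  by ring.
by rewrite a b !(intS, PoszD); ring.
Qed.

(** The coefficient of q_{n+i} in the product q_n q_j. *)
Definition lin_coef (n j i : nat) : int :=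
  'C(j, i)%:Z * 'C(n + i, j)%:Z * 'C(n + j, j)%:Z.

Lemma lin_coef_small (n j : nat) : lin_coef n j j.+1 = 0.
Proof. by rewrite /lin_coef bin_small. Qed.

Lemma lin_coef_rec0 (n j : nat) :
  (j.+1)%:Z ^+ 2 * lin_coef n j.+1 0 =
  (n%:Z * (n.+1)%:Z - j%:Z * (j.+1)%:Z) * lin_coef n j 0.
Proof.
rewrite /lin_coef !bin0 addn0 addnS.
have a := mul_binz_left n j; have b := mul_binz_diag (n + j) j.
transitivity (((j.+1)%:Z * 'C(n, j.+1)%:Z) *
              ((j.+1)%:Z * 'C((n + j).+1, j.+1)%:Z)).
  by ring.
by rewrite a b !(intS, PoszD); ring.
Qed.

(** The relation that the coefficients must satisfy for [legendre_mul] to pass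
    from j to j + 1: multiplication by x - j (j + 1) sends q_m to
    (m + 1)^2 q_{m+1} + (m (m + 1) - j (j + 1)) q_m. *)
Lemma lin_coef_rec (n j i : nat) :
  (j.+1)%:Z ^+ 2 * lin_coef n j.+1 i.+1 =
  ((n + i).+1)%:Z ^+ 2 * lin_coef n j i +
  ((n + i).+1%:Z * (n + i).+2%:Z - j%:Z * (j.+1)%:Z) * lin_coef n j i.+1.
Proof.
rewrite /lin_coef !addnS.
have a := mul_binz_left (n + i).+1 j.
have b := mul_binz_diag (n + j) j.
have c : (n + i).+1%:Z * 'C(n + i, j)%:Z =
         ((n + i).+1%:Z - j%:Z) * 'C((n + i).+1, j)%:Z.
  by rewrite -mul_binz_diag mul_binz_left.
have e := mul_binz_left j i.
transitivity ('C(j.+1, i.+1)%:Z * (j.+1%:Z * 'C((n + i).+1, j.+1)%:Z) *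
              (j.+1%:Z * 'C((n + j).+1, j.+1)%:Z)); first by ring.
transitivity ('C(j, i)%:Z * (n + i).+1%:Z * ((n + i).+1%:Z * 'C(n + i, j)%:Z) *
              'C(n + j, j)%:Z
   + ((n + i).+1%:Z * (n + i).+2%:Z - j%:Z * j.+1%:Z) *
     ('C(j, i.+1)%:Z * 'C((n + i).+1, j)%:Z * 'C(n + j, j)%:Z)); last by ring.
rewrite a b c binS PoszD.
move: e; set x := 'C(j, i)%:Z; set y := 'C(j, i.+1)%:Z.
set u := 'C((n + i).+1, j)%:Z; set v := 'C(n + j, j)%:Z.
rewrite !(intS, PoszD).
move=> e.
have {}e : (1 + i%:Z) * y - (j%:Z - i%:Z) * x = 0 by rewrite e subrr.
apply/eqP; rewrite -subr_eq0; apply/eqP.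
(* The two sides differ by a multiple of the absorption rule for C(j, i + 1). *)
transitivity (- u * v * (n%:Z + i%:Z + 1 - j%:Z) *
              ((1 + i%:Z) * y - (j%:Z - i%:Z) * x)); last by rewrite e mulr0.
by ring.
Qed.

Lemma legendre_mul (n j k : nat) :
  legendre n k * legendre j k =
  \sum_(i < j.+1) lin_coef n j i * legendre (n + i) k.
Proof.
elim: j => [|j IH].
  by rewrite big_ord_recl big_ord0 /lin_coef /legendre /=
    !(addn0, bin0) !(mul1r, mulr1) addr0.
have nz : (j.+1)%:Z ^+ 2 != 0 by [].
apply: (mulfI nz); rewrite mulrCA legendre_recr mulrCA IH !mulr_sumr.
pose c m := m%:Z * m.+1%:Z - j%:Z * j.+1%:Z.
transitivity (\sum_(i < j.+1)
   (((n + i).+1%:Z ^+ 2 * lin_coef n j i) * legendre (n + i).+1 k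
    + (c (n + i)%N * lin_coef n j i) * legendre (n + i) k)).
  apply: eq_bigr => i _.
  by rewrite [_ * legendre _.+1 k]mulrAC legendre_recr /c; ring.
pose G i := c (n + i)%N * lin_coef n j i * legendre (n + i) k.
have G_ext : \sum_(i < j.+1) G i = \sum_(i < j.+2) G i.
  by rewrite [RHS]big_ord_recr /= [X in _ + X]/G lin_coef_small
    mulr0 mul0r addr0.
rewrite big_split /= addrC G_ext /G.
rewrite big_ord_recl [RHS]big_ord_recl /= [X in _ = X + _]mulrA lin_coef_rec0.
rewrite addn0 -addrA; congr (_ + _).
rewrite -big_split /=; apply: eq_bigr => i _.
by rewrite /bump /= !add1n [RHS]mulrA lin_coef_rec addnS /c; ring.
Qed.

(** Reindexing device: it turns a term of index a, whether or not a < N, into a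
    sum over a fixed range, so that sums of shifted sums can be exchanged. *)
Lemma sum_delta (N a : nat) (F : nat -> int) :
  (forall m, (N <= m)%N -> F m = 0) ->
  \sum_(m < N) (m == a :> nat)%:Z * F m = F a.
Proof.
move=> F0; case: (ltnP a N) => [lt_aN | le_Na].
  rewrite (bigD1 (Ordinal lt_aN)) //= eqxx mul1r big1 ?addr0 // => m.
  by rewrite -val_eqE /= => /negPf->; rewrite mul0r.
rewrite F0 // big1 // => m _; case: eqP => [ma|]; last by rewrite mul0r.
by have := ltn_ord m; rewrite ma ltnNge le_Na.
Qed.

(** The weight C(n, j) is what makes the division of the linearization by
    C(2j, j) exact; the weight C(n + i, j) reappears on the right, so that the
    formula can be iterated. *)
Lemma bin_legendre_mul (n j k : nat) :
  'C(n, j)%:Z * legendre n k * 'C(k + j, 2 * j)%:Z =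
  'C(n + j, 2 * j)%:Z *
  \sum_(i < j.+1) 'C(j, i)%:Z * ('C(n + i, j)%:Z * legendre (n + i) k).
Proof.
have nz : 'C(2 * j, j)%:Z != 0 :> int.
  by rewrite -lt0n bin_gt0; lia.
apply: (mulfI nz).
transitivity ('C(n, j)%:Z * (legendre n k * legendre j k)).
  by rewrite (legendre_central j); ring.
rewrite [RHS]mulrA -(PoszM 'C(2 * j, j)) -bin_add_central PoszM legendre_mul.
rewrite !mulr_sumr.
by apply: eq_bigr => i _; rewrite /lin_coef; ring.
Qed.

(** The bound N exceeds every k of interest, and q_m(k) = 0 for m > k; a common
    summation range makes the expansion coefficients independent of k. *)
Lemma power_expansion (j N s : nat) :
  exists v : nat -> int, forall k, (k < N)%N ->
  'C(2 * j, j)%:Z * 'C(k + j, 2 * j)%:Z ^+ s.+1 =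
  \sum_(m < N) v m * ('C(m, j)%:Z * legendre m k).
Proof.
have F0 k : (k < N)%N ->
  forall m, (N <= m)%N -> 'C(m, j)%:Z * legendre m k = 0.
  by move=> lt_kN m le_Nm; rewrite legendre_small ?mulr0 //;
     apply: leq_trans le_Nm.
elim: s => [|s [v IH]].
  exists (fun m => (m == j)%:Z) => k /F0 Fk0.
  by rewrite (@sum_delta N j _ Fk0) binn mul1r expr1 legendre_central.
exists (fun m => \sum_(n < N) \sum_(i < j.+1)
   v n * 'C(n + j, 2 * j)%:Z * 'C(j, i)%:Z *
   (m == n + i :> nat)%N%:Z) => k lt_kN.
rewrite exprSr mulrA IH // mulr_suml.
under [RHS]eq_bigr => m _ do rewrite mulr_suml.
rewrite [RHS]exchange_big /=; apply: eq_bigr => n _.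
rewrite -[LHS]mulrA bin_legendre_mul.
under [RHS]eq_bigr => m _ do rewrite mulr_suml.
rewrite [RHS]exchange_big /= mulrA mulr_sumr; apply: eq_bigr => i _.
rewrite -(@sum_delta N (n + i)%N _ (F0 k lt_kN)) !mulr_sumr.
by apply: eq_bigr => m _; ring.
Qed.

(** Eliminating one binomial between d_{n,k} and
    (n - k) C(2n, n - k) = (n + k + 1) C(2n, n - k - 1) exposes the factor
    n - m that drives the telescoping in [d_orthogonal]. *)
Lemma d_mul_diff (n m k : nat) : (k <= n)%N ->
  (n%:Z - m%:Z) * d n k =
  (k%:Z - m%:Z) * binz (2 * n) (n%:Z - k%:Z)
  + (k%:Z + m%:Z + 1) * binz (2 * n) (n%:Z - k%:Z - 1).
Proof.
move=> le_kn.
suff E : (n%:Z - k%:Z) * binz (2 * n) (n%:Z - k%:Z) =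
         (n%:Z + k%:Z + 1) * binz (2 * n) (n%:Z - k%:Z - 1).
  by rewrite /d; lia.
rewrite subzn //; case def_h: (n - k)%N => [|h].
  by rewrite /= mulr0 mul0r.
have -> : h.+1%:Z - 1 = h%:Z by lia.
rewrite /= mul_binz_left; congr (_ * _); lia.
Qed.

(** For m < n, [d_mul_diff] and
    (k + m + 1) C(k + m, 2m) = (k + 1 - m) C(k + 1 + m, 2m) make n - m times the
    summand a difference g(k) - g(k + 1), up to the global sign (-1)^n, where
    g(k) = (-1)^k C(2n, n - k) (k - m) C(k + m, 2m) vanishes at both ends. *)
Lemma d_orthogonal (n m : nat) : (m <= n)%N ->
  \sum_(k < n.+1) (-1) ^+ (n - k) * d n k * 'C(k + m, 2 * m)%:Z = (m == n)%:Z.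
Proof.
move=> le_mn; case: eqVneq => [->|neq].
  rewrite big_ord_recr /= big1 ?add0r => [|k _].
    by rewrite subnn d_diag addnn -mul2n binn.
  by rewrite [X in X%:Z]bin_small ?mulr0 //; have := ltn_ord k; lia.
have nz : n%:Z - m%:Z != 0 by lia.
apply: (mulfI nz); rewrite mulr0.
pose g k : int := (-1) ^+ k * binz (2 * n) (n%:Z - k%:Z) *
   ((k%:Z - m%:Z) * 'C(k + m, 2 * m)%:Z).
have gS k : g k.+1 = - (-1) ^+ k * binz (2 * n) (n%:Z - k%:Z - 1) *
   ((k%:Z + m%:Z + 1) * 'C(k + m, 2 * m)%:Z).
  rewrite /g exprS mulN1r addSn; congr (_ * binz _ _ * _); first by lia.
  case: (leqP m k) => [le_mk|lt_km]; last first.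
    rewrite (@bin_small (k + m)) ?mulr0; last by lia.
    case: (ltngtP k.+1 m) => [lt|lt|<-]; [|by lia|by rewrite subrr mul0r].
    by rewrite bin_small ?mulr0 //; lia.
  have := mul_bin_down (k + m).+1 (2 * m).
  have -> : ((k + m).+1 - 2 * m = k.+1 - m)%N by lia.
  move=> /= E; nia.
transitivity ((-1) ^+ n * \sum_(k < n.+1) (g k - g k.+1)).
  rewrite !mulr_sumr; apply: eq_bigr => k _.
  have le_kn : (k <= n)%N by rewrite -ltnS.
  have -> : (-1) ^+ (n - k) = (-1) ^+ n * (-1) ^+ k :> int.
    by rewrite -signr_odd oddB // signr_addb !signr_odd.
  transitivity ((-1) ^+ n * (-1) ^+ k * ((n%:Z - m%:Z) * d n k) *
                'C(k + m, 2 * m)%:Z).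
    by ring.
  by rewrite d_mul_diff // gS /g; ring.
have -> : \sum_(k < n.+1) (g k - g k.+1) = g 0%N - g n.+1.
  rewrite -(big_mkord xpredT (fun k => g k - g k.+1)).
  rewrite -opprB -(telescope_sumr g (leq0n _)) -sumrN.
  by apply: eq_bigr => k _; rewrite opprB.
have -> : g n.+1 = 0.
  rewrite /g; have -> : n%:Z - n.+1%:Z = -1 by lia.
  by rewrite /= mulr0 mul0r.
rewrite /g; case: (m) => [|m']; first by rewrite subrr mul0r mulr0 subr0 mulr0.
by rewrite (@bin_small (0 + _)) ?mulr0 ?subr0 ?mulr0 //; lia.
Qed.

(** For r > 0 the range of summation may start at 0, because C(k + j, 2j) = 0
    for k < j. *)
Lemma t_sum_from0 (r n j : nat) : (0 < r)%N -> (j <= n)%N ->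
  t r n j = \sum_(k < n.+1) (-1) ^+ (n - k) * d n k * 'C(k + j, 2 * j)%:Z ^+ r.
Proof.
move=> r_gt0 le_jn.
rewrite -(big_mkord xpredT
  (fun k => (-1) ^+ (n - k) * d n k * 'C(k + j, 2 * j)%:Z ^+ r)).
rewrite (big_cat_nat (leq0n j)) ?leqW //= big_nat big1 ?add0r => [|k lt_kj].
  apply: eq_big_nat => k /andP[le_jk _].
  by rewrite -bin_sub; [congr (_ * 'C(_, _)%:Z ^+ _); lia | lia].
by rewrite bin_small ?expr0n ?(gtn_eqF r_gt0) ?mulr0 //; lia.
Qed.

Theorem theorem2 (r n j : nat) (hr : (2 <= r)%N) (hj : (j <= n)%N) :
  ('C(2 * n, n)%:R : rat)^-1 * 'C(2 * j, j)%:R * (t r n j)%:~R \is a Num.int.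
Proof.
case: r hr => // s _.
have [v pow_eq] := power_expansion j n.+1 s.
have E : 'C(2 * j, j)%:Z * t s.+1 n j = 'C(2 * n, n)%:Z * (v n * 'C(n, j)%:Z).
  rewrite t_sum_from0 // mulr_sumr.
  transitivity (\sum_(k < n.+1) \sum_(m < n.+1)
     v m * 'C(m, j)%:Z * 'C(2 * m, m)%:Z *
     ((-1) ^+ (n - k) * d n k * 'C(k + m, 2 * m)%:Z)).
    apply: eq_bigr => k _; rewrite mulrCA pow_eq // mulr_sumr.
    by apply: eq_bigr => m _; rewrite legendre_central; ring.
  rewrite exchange_big /= big_ord_recr /= big1 ?add0r => [|m _].
    by rewrite -mulr_sumr d_orthogonal // eqxx mulr1 mulrC.
  by rewrite -mulr_sumr d_orthogonal ?(ltn_eqF (ltn_ord m)) ?mulr0 // ltnW.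
have nz : 'C(2 * n, n)%:R != 0 :> rat by rewrite pnatr_eq0 -lt0n bin_gt0; lia.
have {}E := congr1 (fun z : int => z%:~R : rat) E.
rewrite /= !rmorphM /= in E.
rewrite -mulrA E mulKf //.
by rewrite rpredM ?intr_int.
Qed.
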